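(* Let $K$ be a number field, let $d\ge 2$, and let $f(z)\in K[z]$ be a unicritical polynomial of degree $d$. Then either $f(z)$ is $\overline{K}$-conjugate to $z^d$, or $f$ is $\overline{K}$-conjugate to a unique polynomial of the form $az^d+1\in K[z]$ (with $a\neq 0$).
   Context: A polynomial $f$ is unicritical if it has exactly one critical point in $\overline{K}$, i.e. exactly one $\gamma\in\overline K$ with $f'(\gamma)=0$. Polynomials $f,g$ are $\overline{K}$-conjugate if $g=\phi\circ f\circ\phi^{-1}$ for some affine map $\phi(z)=\alpha z+\beta$ with $\alpha,\beta\in\overline{K}$, $\alpha\neq 0$. *)

(* Defs.v *)
From HB Require Import structures.
From mathcomp Require Import all_boot all_order all_algebra all_field.

Set Implicit Arguments.
Unset Strict Implicit.
Unset Printing Implicit Defensive.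

Import GRing.Theory.
Local Open Scope ring_scope.

Definition is_algebraic_closure (K : fieldType) (Kbar : closedFieldType)
    (iota : {rmorphism K -> Kbar}) : Prop :=
  forall x : Kbar, algebraicOver iota x.

Definition unicritical (K : fieldType) (Kbar : closedFieldType)
    (iota : {rmorphism K -> Kbar}) (f : {poly K}) : Prop :=
  exists! gamma : Kbar, (map_poly iota f^`()).[gamma] = 0.

Definition affine_poly (F : fieldType) (alpha beta : F) : {poly F} :=
  alpha *: 'X + beta%:P.

(* The compositional inverse of affine_poly alpha beta when alpha != 0. *)
Definition affine_inv (F : fieldType) (alpha beta : F) : {poly F} :=
  alpha^-1 *: ('X - beta%:P).

Definition conjugate (K : fieldType) (Kbar : closedFieldType)
    (iota : {rmorphism K -> Kbar}) (f g : {poly K}) : Prop :=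
  exists alpha beta : Kbar, alpha != 0 /\
    map_poly iota g =
      affine_poly alpha beta \Po (map_poly iota f \Po affine_inv alpha beta).

(* Main.v *)
(** Let [gamma] be the critical point.  Over the algebraic closure [f'] is a
    constant times [(X - gamma)^n] with [n >= 1]; its two top coefficients lie in
    [K], and their ratio is [- n * gamma], so in characteristic zero [gamma] is
    in [K] and [f = a (X - gamma)^d + b] over [K].
    A conjugation by [alpha z + beta] that produces a polynomial with critical
    point [0] must have [beta = - alpha * gamma], and then yields
    [alpha^(1-d) a X^d + alpha (b - gamma)].  If [b = gamma], choosing
    [alpha^(d-1) = a] gives [X^d]; otherwise the constant term is [1] exactly for
    [alpha = (b - gamma)^-1], which lies in [K]. *)

Require Import Defs.
From HB Require Import structures.
From mathcomp Require Import all_boot all_order all_algebra all_field.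

Set Implicit Arguments.
Unset Strict Implicit.
Unset Printing Implicit Defensive.

Import GRing.Theory.
Local Open Scope ring_scope.

(** Over a closed field [p] splits into linear factors; every entry of its list of roots equals [c],
    so the list is constant and its length is the degree. *)
Lemma closed_poly_one_root (F : closedFieldType) (p : {poly F}) (c : F) :
  p != 0 -> (forall z, root p z -> z = c) ->
  p = lead_coef p *: ('X - c%:P) ^+ (size p).-1.
Proof.
move=> p_neq0 root_c; have [r def_p] := closed_field_poly_normal p.
have r_c : r = nseq (size r) c.
  apply/all_pred1P/allP => z rz; apply/eqP/root_c.
  by rewrite def_p rootZ ?lead_coef_eq0 // root_prod_XsubC.
have sz_p : size p = (size r).+1.
  by rewrite {1}def_p size_scale ?lead_coef_eq0 // size_prod_XsubC.
by rewrite {1}def_p sz_p {1}r_c big_nseq -Monoid.iteropE.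
Qed.

Lemma deriv_eq0_pchar0 (F : fieldType) (p : {poly F}) :
  [pchar F] =i pred0 -> p^`() = 0 -> p = (p`_0)%:P.
Proof.
move=> /pcharf0P char0 dp0; apply/polyP => -[|i]; rewrite coefC //=.
have /eqP := congr1 (coefp i) dp0.
rewrite /= coef_deriv coef0 -mulr_natr mulf_eq0 char0 orbF.
by move/eqP.
Qed.

(** Vieta: the subleading coefficient is minus the sum of the [n.+1] roots, all equal to [c]. *)
Lemma coef_XsubC_exp (R : comNzRingType) (c : R) (n : nat) :
  (('X - c%:P) ^+ n.+1)`_n = - (c *+ n.+1).
Proof.
have := @coefPn_prod_XsubC _ (nseq n.+1 c) isT.
by rewrite size_nseq !big_nseq -!Monoid.iteropE.
Qed.

Lemma unicritical_normal_form (K : fieldType) (Kbar : closedFieldType)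
    (iota : {rmorphism K -> Kbar}) (d : nat) (f : {poly K}) :
  [pchar K] =i pred0 -> (2 <= d)%N -> size f = d.+1 -> unicritical iota f ->
  exists a b c : K, a != 0 /\ f = a *: ('X - c%:P) ^+ d + b%:P.
Proof.
move=> char0 d_ge2 sz_f [g [g_crit g_uniq]].
have nat_neq0 m : m.+1%:R != 0 :> K by rewrite ((pcharf0P _).1 char0).
have df_neq0 : f^`() != 0.
  apply: contraL d_ge2 => /eqP/(deriv_eq0_pchar0 char0) f_const.
  by rewrite -ltnS -sz_f f_const -leqNgt (leq_trans (size_polyC_leq1 _)).
set a := lead_coef f^`().
have a_neq0 : a != 0 by rewrite lead_coef_eq0.
have := @closed_poly_one_root _ (map_poly iota f^`()) g.
rewrite map_poly_eq0 lead_coef_map size_map_poly.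
move/(_ df_neq0 (fun z rz => esym (g_uniq z (eqP rz)))).
(* For exponent [0] the derivative would be a nonzero constant, against the existence of the
   critical point [g]. *)
case: (size _).-1 => [|n] def_df.
  move: g_crit; rewrite def_df expr0 hornerZ hornerC mulr1 => /eqP.
  by rewrite fmorph_eq0 (negPf a_neq0).
pose c := - (f^`()`_n / (a * n.+1%:R)).
have def_g : g = iota c.
  have := congr1 (coefp n) def_df.
  rewrite /= coef_map coefZ coef_XsubC_exp rmorphN fmorph_div => ->.
  rewrite rmorphM rmorph_nat -(mulr_natr g) mulrN mulNr opprK.
  rewrite mulrCA mulfK // -(rmorph_nat iota) -rmorphM fmorph_eq0.
  by rewrite mulf_neq0.
have def_df_K : f^`() = a *: ('X - c%:P) ^+ n.+1.
  apply: (map_poly_inj iota); rewrite def_df def_g.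
  by rewrite map_polyZ rmorphXn rmorphB /= map_polyX map_polyC.
(* Integrating [def_df_K] gives this leading coefficient; what then remains of [f] has zero
   derivative, hence is constant. *)
pose a' := a / n.+2%:R.
have a'_neq0 : a' != 0 by rewrite mulf_neq0 ?invr_eq0.
have dq : (f - a' *: ('X - c%:P) ^+ n.+2)^`() = 0.
  rewrite derivB derivZ deriv_exp derivXsubC mul1r def_df_K /= -scaler_nat.
  by rewrite scalerA divfK ?subrr.
have := deriv_eq0_pchar0 char0 dq; set b := _`_0 => /eqP.
rewrite subr_eq addrC => /eqP def_f.
suff def_d : d = n.+2 by exists a', b, c; rewrite def_d.
apply: succn_inj; rewrite -sz_f def_f size_polyDl size_scale // size_exp_XsubC //.
by rewrite (leq_ltn_trans (size_polyC_leq1 _)).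
Qed.

Lemma conj_normal_form (F : fieldType) (al be a b c : F) (d : nat) :
  affine_poly al be \Po
    ((a *: ('X - c%:P) ^+ d + b%:P) \Po affine_inv al be) =
  (al * a) *: (al^-1 *: 'X - (al^-1 * be + c)%:P) ^+ d + (al * b + be)%:P.
Proof.
rewrite /affine_poly /affine_inv !(comp_polyD, comp_polyZ, comp_polyC).
rewrite comp_polyX rmorphXn /= comp_polyB comp_polyX comp_polyC.
rewrite scalerDr scalerA scalerBr -addrA -!mul_polyC -!polyCM -polyCD.
by rewrite -addrA -opprD -polyCD.
Qed.

(** This translation part sends the critical point [c] to [0], so the power becomes a pure
    monomial. *)
Lemma conj_at_crit (F : fieldType) (al a b c : F) (d : nat) : al != 0 ->
  affine_poly al (- (al * c)) \Po
    ((a *: ('X - c%:P) ^+ d.+1 + b%:P) \Po affine_inv al (- (al * c))) =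
  (a / al ^+ d) *: 'X^(d.+1) + (al * (b - c))%:P.
Proof.
move=> al_neq0; rewrite conj_normal_form mulrN mulKf // addNr subr0.
rewrite exprZn scalerA mulrBr exprS exprVn; congr (_ *: _ + _).
by rewrite mulrACA mulfV ?mul1r.
Qed.

(* Both sides must have vanishing derivative at [0]. *)
Lemma conj_to_centered (F : fieldType) (al be a b c a' b' : F) (n : nat) :
  [pchar F] =i pred0 -> al != 0 -> a != 0 ->
  a' *: 'X^(n.+2) + b'%:P =
    affine_poly al be \Po
      ((a *: ('X - c%:P) ^+ n.+2 + b%:P) \Po affine_inv al be) ->
  be = - (al * c).
Proof.
move=> char0 al_neq0 a_neq0; rewrite conj_normal_form.
move/(congr1 (fun p : {poly F} => p^`().[0])).
rewrite !(derivD, derivC, derivZ) derivXn deriv_exp derivB derivZ derivX derivC.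
rewrite !addr0 subr0 /=.
rewrite !(hornerZ, hornerMn, hornerM, horner_exp, hornerD, hornerN, hornerX, hornerC).
rewrite exprS mul0r !mul0rn !mulr0 add0r.
(* What remains is a nonzero scalar times a power of [- (al^-1 * be + c)], so this base vanishes. *)
move/esym/eqP; rewrite mulr1 mulrnAr -mulr_natr mulf_eq0 ((pcharf0P _).1 char0).
rewrite !mulf_eq0 expf_eq0 invr_eq0 (negPf al_neq0) (negPf a_neq0) !orbF /=.
rewrite oppr_eq0 addr_eq0 => /eqP be_c.
by rewrite -mulrN -be_c mulVKf.
Qed.

Theorem theorem2p1 (K : fieldExtType rat) (Kbar : closedFieldType)
    (iota : {rmorphism K -> Kbar}) (hKbar : is_algebraic_closure iota)
    (d : nat) (hd : (2 <= d)%N) (f : {poly K})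
    (hdeg : size f = d.+1) (hf : unicritical iota f) :
  conjugate iota f 'X^d \/
  (exists! g : {poly K},
     (exists a : K, a != 0 /\ g = a *: 'X^d + 1) /\ conjugate iota f g).
Proof.
have char0 : [pchar K] =i pred0.
  by move=> p; rewrite pchar_lalg Num.Theory.pchar_num.
have char0bar : [pchar Kbar] =i pred0.
  by move=> p; rewrite (fmorph_pchar iota) char0.
have [a [b [c [a_neq0 def_f]]]] := unicritical_normal_form char0 hd hdeg hf.
case: d hd def_f {hdeg} => [|[|n]] // _ def_f.
have map_f : map_poly iota f =
    iota a *: ('X - (iota c)%:P) ^+ n.+2 + (iota b)%:P.
  rewrite def_f rmorphD /= map_polyZ rmorphXn rmorphB /=.
  by rewrite map_polyX !map_polyC.
have [def_b | b_neq_c] := eqVneq b c.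
  left; have [al al_a] : exists al, al ^+ n.+1 = iota a.
    (* The coefficients vanish except at index [0], so the monic equation solved is
       [al ^+ n.+1 = iota a]. *)
    have [//|al] := @solve_monicpoly Kbar n.+1 (fun i => (i == 0)%:R * iota a).
    rewrite big_ord_recl big1 => [|i _]; last by rewrite !mul0r.
    by rewrite mul1r mulr1 addr0; exists al.
  have al_neq0 : al != 0.
    by move: a_neq0; rewrite -(fmorph_eq0 iota) -al_a expf_eq0.
  exists al, (- (al * iota c)); split=> //.
  rewrite map_f conj_at_crit // def_b subrr mulr0 addr0 al_a.
  by rewrite mulfV ?fmorph_eq0 // scale1r map_polyXn.
right; have bc_neq0 : b - c != 0 by rewrite subr_eq0.
(* The leading coefficient given by [conj_at_crit] for the scaling [(b - c)^-1]. *)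
exists ((a / (b - c)^-1 ^+ n.+1) *: 'X^(n.+2) + 1); split.
  split; first by eexists; split; last by [];
    rewrite mulf_neq0 // invr_eq0 expf_neq0 ?invr_eq0.
  exists (iota (b - c)^-1), (- (iota (b - c)^-1 * iota c)).
  split; first by rewrite fmorph_eq0 invr_eq0.
  rewrite map_f conj_at_crit ?fmorph_eq0 ?invr_eq0 //.
  rewrite -rmorphB -rmorphM mulVf // rmorph1 rmorphD rmorph1 /=.
  by rewrite map_polyZ map_polyXn fmorph_div rmorphXn.
move=> _ [[a' [_ ->]]] [al [be [al_neq0]]].
rewrite map_f rmorphD rmorph1 /= map_polyZ map_polyXn -polyC1 => conj_g.
have ia_neq0 : iota a != 0 by rewrite fmorph_eq0.
have def_be := conj_to_centered char0bar al_neq0 ia_neq0 conj_g.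
rewrite {be}def_be conj_at_crit // in conj_g.
(* The constant term determines [al], and the leading coefficient then determines [iota a'], hence
   [a'] by injectivity. *)
have /= := congr1 (coefp 0) conj_g; have /= := congr1 (coefp n.+2) conj_g.
rewrite !coefE !eqxx /= !mulr1 !mulr0 !addr0 !add0r => def_a' /esym def_al.
suff -> : a' = a / (b - c)^-1 ^+ n.+1 by [].
have {}def_al : al = iota (b - c)^-1.
  by rewrite fmorphV rmorphB -[RHS]mul1r -def_al mulfK // -rmorphB fmorph_eq0.
by apply: (fmorph_inj iota); rewrite def_a' def_al fmorph_div rmorphXn.
Qed.
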